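(* Let $\mathcal M=(\mathcal H_A,\xi,\mathcal E,\mathsf Z)$ be a measurement scheme constrained by the third law. Suppose it implements an $\mathsf E$-instrument $\mathcal I$, where $\mathsf E$ is a non-trivial observable on $\mathcal H_S$. If $\mathcal I$ is extremal, then: (i) $\operatorname{rank}\mathsf E_x\ge\sqrt{\dim\mathcal H_S}$ for every $x\in\mathcal X$; (ii) $\mathcal E$ is not a unitary channel, i.e. there is no unitary $U$ on $\mathcal H_S\otimes\mathcal H_A$ with $\mathcal E(\cdot)=U\cdot U^*$.
   Context: All Hilbert spaces are finite-dimensional and complex. A state is a positive operator of unit trace; it is full-rank if it is positive definite. A channel is a completely positive trace-preserving linear map. A channel is constrained by the third law if it maps every full-rank state on its input space to a full-rank state on its output space. Let $2\le\dim\mathcal H_S<\infty$. An observable is a finite family $\mathsf E=\{\mathsf E_x\}_{x\in\mathcal X}$ of nonzero operators with $0\le\mathsf E_x\le\mathbb 1$ and $\sum_x\mathsf E_x=\mathbb 1$. It is non-trivial if some $\mathsf E_x$ is not a multiple of $\mathbb 1$. An $\mathsf E$-instrument is a family $\{\mathcal I_x\}_{x\in\mathcal X}$ of completely positive maps on $\mathcal L(\mathcal H_S)$ with $\mathrm{tr}[\mathcal I_x(\rho)]=\mathrm{tr}[\mathsf E_x\rho]$ for all $x$ and all states $\rho$. A measurement scheme $(\mathcal H_A,\xi,\mathcal E,\mathsf Z)$ consists of: - a finite-dimensional $\mathcal H_A$; - a state $\xi$ on $\mathcal H_A$; - a channel $\mathcal E$ on $\mathcal L(\mathcal H_S\otimes\mathcal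 H_A)$; - positive operators $\{\mathsf Z_x\}_{x\in\mathcal X}$ on $\mathcal H_A$ summing to $\mathbb 1$. It implements $\mathcal I_x(\rho)=\mathrm{tr}_A[(\mathbb 1\otimes\mathsf Z_x)\mathcal E(\rho\otimes\xi)]$. It is constrained by the third law if $\xi$ is full-rank and $\mathcal E$ is constrained by the third law. An instrument $\mathcal I$ with outcome set $\mathcal X$ is extremal if the following holds: whenever $\mathcal I_x=\lambda\mathcal I^{(1)}_x+(1-\lambda)\mathcal I^{(2)}_x$ for all $x$, with $\lambda\in(0,1)$ and $\mathcal I^{(1)},\mathcal I^{(2)}$ instruments with outcome set $\mathcal X$ (families of completely positive maps whose sum is trace-preserving), then $\mathcal I^{(1)}=\mathcal I^{(2)}=\mathcal I$. *)

(* Defs.v *)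
From HB Require Import structures.
From mathcomp Require Import all_boot all_order all_algebra.
From mathcomp.real_closed Require Import complex mxtens.
From mathcomp Require Import reals.
Set Implicit Arguments. Unset Strict Implicit. Unset Printing Implicit Defensive.
Import Order.TTheory GRing.Theory Num.Theory.
Local Open Scope ring_scope.
Local Open Scope sesquilinear_scope.

Section QDefs.
Variable C : numClosedFieldType.

Definition psd {n} (A : 'M[C]_n) : Prop :=
  forall v : 'cV[C]_n, 0 <= (v ^t* *m A *m v) 0 0.

Definition pd {n} (A : 'M[C]_n) : Prop :=
  forall v : 'cV[C]_n, v != 0 -> 0 < (v ^t* *m A *m v) 0 0.

Definition state {n} (rho : 'M[C]_n) : Prop := psd rho /\ \tr rho = 1.

Definition full_rank_state {n} (rho : 'M[C]_n) : Prop := pd rho /\ \tr rho = 1.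

(* Ampliation id_k (x) Phi on L(C^k (x) C^n); C^k (x) C^n is indexed by
   mxtens_index (i, a) with i : 'I_k, a : 'I_n. *)
Definition ampl {n m} (k : nat) (Phi : 'M[C]_n -> 'M[C]_m) (Y : 'M[C]_(k * n))
  : 'M[C]_(k * m) :=
  \matrix_(p, q)
    Phi (\matrix_(a, b) Y (mxtens_index ((mxtens_unindex p).1, a))
                          (mxtens_index ((mxtens_unindex q).1, b)))
        (mxtens_unindex p).2 (mxtens_unindex q).2.

Definition completely_positive {n m} (Phi : 'M[C]_n -> 'M[C]_m) : Prop :=
  forall (k : nat) (Y : 'M[C]_(k * n)), psd Y -> psd (@ampl n m k Phi Y).

Definition trace_preserving {n m} (Phi : 'M[C]_n -> 'M[C]_m) : Prop :=
  forall Y, \tr (Phi Y) = \tr Y.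

Definition channel {n m} (Phi : {linear 'M[C]_n -> 'M[C]_m}) : Prop :=
  completely_positive Phi /\ trace_preserving Phi.

Definition third_law_channel {n m} (Phi : 'M[C]_n -> 'M[C]_m) : Prop :=
  forall rho, full_rank_state rho -> full_rank_state (Phi rho).

Definition unitary_channel {n} (Phi : 'M[C]_n -> 'M[C]_n) : Prop :=
  exists U : 'M[C]_n, U \is unitarymx /\ forall Y, Phi Y = U *m Y *m U ^t*.

Definition observable {d} {X : finType} (E : X -> 'M[C]_d) : Prop :=
  [/\ forall x, E x != 0,
      forall x, psd (E x),
      forall x, psd (1%:M - E x)
    & \sum_x E x = 1%:M].

Definition nontrivial_observable {d} {X : finType} (E : X -> 'M[C]_d) : Prop :=
  exists x, ~ exists c : C, E x = c%:M.

Definition E_instrument {d} {X : finType} (E : X -> 'M[C]_d)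
    (I : X -> {linear 'M[C]_d -> 'M[C]_d}) : Prop :=
  (forall x, completely_positive (I x)) /\
  (forall x rho, state rho -> \tr (I x rho) = \tr (E x *m rho)).

Definition instrument {d} {X : finType}
    (I : X -> {linear 'M[C]_d -> 'M[C]_d}) : Prop :=
  (forall x, completely_positive (I x)) /\
  (forall Y, \tr (\sum_x I x Y) = \tr Y).

Definition extremal_instrument {d} {X : finType}
    (I : X -> {linear 'M[C]_d -> 'M[C]_d}) : Prop :=
  forall (lam : C) (I1 I2 : X -> {linear 'M[C]_d -> 'M[C]_d}),
    0 < lam < 1 -> instrument I1 -> instrument I2 ->
    (forall x Y, I x Y = lam *: I1 x Y + (1 - lam) *: I2 x Y) ->
    (forall x Y, I1 x Y = I x Y) /\ (forall x Y, I2 x Y = I x Y).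

Definition ptrA {d k} (Y : 'M[C]_(d * k)) : 'M[C]_d :=
  \matrix_(i, j) \sum_(a < k) Y (mxtens_index (i, a)) (mxtens_index (j, a)).

Definition measurement_scheme {d k} {X : finType} (xi : 'M[C]_k)
    (Ch : {linear 'M[C]_(d * k) -> 'M[C]_(d * k)}) (Z : X -> 'M[C]_k) : Prop :=
  [/\ state xi, channel Ch, forall x, psd (Z x) & \sum_x Z x = 1%:M].

Definition implements {d k} {X : finType} (xi : 'M[C]_k)
    (Ch : {linear 'M[C]_(d * k) -> 'M[C]_(d * k)}) (Z : X -> 'M[C]_k)
    (I : X -> {linear 'M[C]_d -> 'M[C]_d}) : Prop :=
  forall x (rho : 'M[C]_d),
    I x rho = ptrA ((1%:M *t Z x) *m Ch (rho *t xi)).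

Definition third_law_scheme {d k} (xi : 'M[C]_k)
    (Ch : {linear 'M[C]_(d * k) -> 'M[C]_(d * k)}) : Prop :=
  pd xi /\ third_law_channel Ch.

End QDefs.

(* Main.v *)
(** Let [K_1, ..., K_N] be linearly independent Kraus operators of [I_x], and let
    [c] be a Hermitian matrix with [\sum_ij c_ij K_j^* K_i = 0].  For small [e > 0]
    the maps [Y |-> \sum_ij (1 +- e c)_ij K_i Y K_j^*] are completely positive,
    leave the effect [E_x = \sum_i K_i^* K_i] unchanged and have midpoint [I_x];
    extremality forces [c = 0].  As each [K_i] factors through the support of
    [E_x], the products [K_j^* K_i] span a space of dimension at most [r^2], where
    [r = rank E_x], so that [N <= r].  By the third law [I_x(1) = \sum_i K_i K_i^*]
    has full rank, while its rank is at most [N r]; hence [dim H_S <= r^2].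

    Since [xi] has full rank it can be moved along any traceless direction, so by
    extremality the instrument does not depend on the apparatus state.  If the
    channel is conjugation by [U], this says that [U^* (B (x) Z_x) U] always has
    the form [M_x(B) (x) 1], with [M_x(1) = E_x].  Summing over [x], the map
    [B |-> \sum_x M_x(B)] is injective, hence onto, and its values commute with
    [E_x] because [B (x) 1] commutes with [1 (x) Z_x].  So every [E_x] would be
    scalar. *)
Require Import Defs.
From HB Require Import structures.
From mathcomp Require Import all_boot all_order all_algebra.
From mathcomp.real_closed Require Import complex mxtens.
From mathcomp Require Import reals.
From mathcomp Require Import ring.
Set Implicit Arguments. Unset Strict Implicit. Unset Printing Implicit Defensive.
Import Order.TTheory GRing.Theory Num.Theory.
Local Open Scope ring_scope.
Local Open Scope sesquilinear_scope.

(** * Positive matrices *)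

Section Adjoint.
Variable C : numClosedFieldType.

Lemma trmxCE m n (A : 'M[C]_(m, n)) i j : A ^t* i j = (A j i)^*.
Proof. by rewrite !mxE. Qed.

Lemma trmxCM m n p (A : 'M[C]_(m, n)) (B : 'M[C]_(n, p)) :
  (A *m B) ^t* = B ^t* *m A ^t*.
Proof. by rewrite trmx_mul map_mxM. Qed.

Lemma trmxCD m n (A B : 'M[C]_(m, n)) : (A + B) ^t* = A ^t* + B ^t*.
Proof. by rewrite linearD map_mxD. Qed.

Lemma trmxCB m n (A B : 'M[C]_(m, n)) : (A - B) ^t* = A ^t* - B ^t*.
Proof. by rewrite linearB map_mxB. Qed.

Lemma trmxCZ m n (a : C) (A : 'M[C]_(m, n)) : (a *: A) ^t* = a^* *: A ^t*.
Proof. by rewrite linearZ map_mxZ. Qed.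

Lemma trmxC_sum m n (J : finType) (F : J -> 'M[C]_(m, n)) :
  (\sum_j F j) ^t* = \sum_j (F j) ^t*.
Proof. by rewrite linear_sum map_mx_sum. Qed.

Lemma trmxC1 n : (1%:M : 'M[C]_n) ^t* = 1%:M.
Proof. by rewrite trmx1 map_mx1. Qed.

Lemma dotE n (u v : 'cV[C]_n) :
  (u ^t* *m v) 0 0 = \sum_i (u i 0)^* * v i 0.
Proof. by rewrite mxE; apply: eq_bigr => i _; rewrite trmxCE. Qed.

Lemma formE m n (A : 'M[C]_(m, n)) (u : 'cV[C]_m) (v : 'cV[C]_n) :
  (u ^t* *m A *m v) 0 0 = \sum_i \sum_j (u i 0)^* * A i j * v j 0.
Proof.
rewrite mxE exchange_big; apply: eq_bigr => j _; rewrite mxE mulr_suml.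
by apply: eq_bigr => i _; rewrite trmxCE.
Qed.

Lemma dot_ge0 n (v : 'cV[C]_n) : 0 <= (v ^t* *m v) 0 0.
Proof. by rewrite dotE sumr_ge0 // => i _; rewrite mulrC mul_conjC_ge0. Qed.

Lemma dot_eq0 n (v : 'cV[C]_n) : (v ^t* *m v) 0 0 = 0 -> v = 0.
Proof.
rewrite dotE => /eqP; rewrite psumr_eq0 => [|i _]; last first.
  by rewrite mulrC mul_conjC_ge0.
move=> /allP v0; apply/colP => i; apply/eqP.
by have := v0 i (mem_index_enum _); rewrite /= mulrC mul_conjC_eq0 mxE.
Qed.

Lemma dot_gt0 n (v : 'cV[C]_n) : v != 0 -> 0 < (v ^t* *m v) 0 0.
Proof.
by move=> vN0; rewrite lt0r dot_ge0 andbT; apply: contraNneq vN0 => /dot_eq0->.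
Qed.

Lemma gram_form m n p (S : 'M[C]_(m, n)) (v : 'M[C]_(m, p)) :
  v ^t* *m (S *m S ^t*) *m v = (S ^t* *m v) ^t* *m (S ^t* *m v).
Proof. by rewrite trmxCM trmxCK !mulmxA. Qed.

Lemma psd_gram m n (S : 'M[C]_(m, n)) : psd (S *m S ^t*).
Proof. by move=> v; rewrite gram_form dot_ge0. Qed.

Lemma pd_gram n (S : 'M[C]_n) : S \in unitmx -> pd (S *m S ^t*).
Proof.
move=> Su v vN0; rewrite gram_form dot_gt0 //.
apply: contraNneq vN0 => Sv0.
have Scu : S ^t* \in unitmx by rewrite map_unitmx unitmx_tr.
by rewrite -(mulKmx Scu v) Sv0 mulmx0.
Qed.

Lemma pd_psd n (A : 'M[C]_n) : pd A -> psd A.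
Proof.
move=> Apd v; have [->|/Apd/ltW //] := eqVneq v 0.
by rewrite mulmx0 mxE.
Qed.

Lemma psdD n (A B : 'M[C]_n) : psd A -> psd B -> psd (A + B).
Proof. by move=> pA pB v; rewrite mulmxDr mulmxDl mxE addr_ge0. Qed.

Lemma pdZ n a (A : 'M[C]_n) : 0 < a -> pd A -> pd (a *: A).
Proof.
by move=> a0 pA v /pA v0; rewrite -scalemxAr -scalemxAl mxE mulr_gt0.
Qed.

Lemma pd1 n : pd (1%:M : 'M[C]_n).
Proof.
rewrite -[X in pd X]mul1mx -[X in pd (_ *m X)]trmxC1.
exact/pd_gram/unitmx1.
Qed.

Lemma form_delta n (A : 'M[C]_n) i j :
  ((delta_mx i 0 : 'cV_n) ^t* *m A *m (delta_mx j 0 : 'cV_n)) 0 0 = A i j.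
Proof.
by rewrite trmx_delta map_delta_mx -rowE -colE !mxE.
Qed.

Lemma pd_trace_gt0 n (A : 'M[C]_n) : (0 < n)%N -> pd A -> 0 < \tr A.
Proof.
case: n A => // n A _ pA; rewrite /mxtrace.
have A_gt0 i : 0 < A i i.
  rewrite -form_delta; apply: pA; apply/eqP => /colP/(_ i); rewrite !mxE !eqxx => /eqP.
  by rewrite oner_eq0.
by rewrite big_ord_recl ltr_pwDl // sumr_ge0 // => i _; apply/ltW.
Qed.

(* Polarization, using that the quadratic form of [A] is real. *)
Lemma psd_herm n (A : 'M[C]_n) : psd A -> A ^t* = A.
Proof.
move=> pA; pose f u v := (u ^t* *m A *m v : 'M[C]_1) 0 0.
have fDl u u' v : f (u + u') v = f u v + f u' v.
  by rewrite /f trmxCD !mulmxDl mxE.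
have fDr u v v' : f u (v + v') = f u v + f u v' by rewrite /f mulmxDr mxE.
have fZl a u v : f (a *: u) v = a^* * f u v.
  by rewrite /f trmxCZ -!scalemxAl mxE.
have fZr a u v : f u (a *: v) = a * f u v by rewrite /f -scalemxAr mxE.
have fR u : (f u u)^* = f u u by apply/CrealP/ger0_real/pA.
have E1 u v : (f u v)^* + (f v u)^* = f u v + f v u.
  have := fR (u + v); rewrite !fDl !fDr !rmorphD /= !fR => E.
  apply: (addrI (f u u)); apply: (addIr (f v v)).
  by move: E; rewrite !addrA.
have E2 u v : (f u v)^* = f v u.
  have := E1 u ('i *: v); rewrite fZl fZr !rmorphM /= !conjCK !conjCi => E.
  have {}E : 'i * ((f v u)^* - (f u v)^*) = 'i * (f u v - f v u).
    by rewrite !mulrBr addrC -!mulNr E.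
  have {E} := mulfI (neq0Ci _) E => E.
  have := E1 u v => E'.
  have : (f v u)^* *+ 2 = f u v *+ 2.
    have -> : (f v u)^* *+ 2 = (f v u)^* - (f u v)^* + ((f u v)^* + (f v u)^*).
      by ring.
    by rewrite E E'; ring.
  move/(pmulrnI (isT : (0 < 2)%N)) => E3.
  by rewrite -E3 conjCK.
apply/matrixP => i j; rewrite trmxCE.
by rewrite -(form_delta A j i) -(form_delta A i j); apply: E2.
Qed.

End Adjoint.

(** * Factorization and perturbation of positive matrices, separation by states *)

Section Positive.
Variable C : numClosedFieldType.

(** Unitary diagonalization: the eigenvalues are values of the quadratic form, hence nonnegative,
    and [S] is built from their square roots. *)
Lemma psd_factor n (A : 'M[C]_n) : psd A -> exists S : 'M_n, A = S *m S ^t*.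
Proof.
move=> pA; have Ah : A \is hermsymmx.
  by apply/is_hermitianmxP; rewrite expr0 scale1r psd_herm.
have /hermitian_normalmx/orthomx_spectralP := Ah.
set P := spectralmx A; set D := spectral_diag A => defA.
have Pu : P \is unitarymx by exact: spectral_unitarymx.
have D_ge0 i : 0 <= D 0 i.
  have -> : D 0 i = (diag_mx D) i i by rewrite mxE eqxx.
  have -> : diag_mx D = P *m A *m P ^t*.
    by rewrite {1}defA !mulmxA mulmxV ?unitarymx_unit // mul1mx mulmxtVK.
  rewrite -form_delta.
  have := pA (P ^t* *m delta_mx i 0).
  by rewrite trmxCM trmxCK !mulmxA.
exists (P ^t* *m diag_mx (map_mx sqrtC D)).
rewrite trmxCM trmxCK {1}defA invmx_unitary // !mulmxA; congr (_ *m P).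
rewrite -!mulmxA; congr (_ *m _).
rewrite tr_diag_mx map_diag_mx mulmx_diag; congr diag_mx.
apply/rowP => i; rewrite !mxE [X in _ * X]geC0_conj ?sqrtC_ge0 //.
by rewrite -expr2 sqrtCK.
Qed.

(** The factor is invertible because [A] is: a nonzero kernel vector of [A] would make the form
    vanish. *)
Lemma pd_factor n (A : 'M[C]_n) :
  pd A -> exists2 S : 'M_n, S \in unitmx & A = S *m S ^t*.
Proof.
move=> pA; have [S defA] := psd_factor (pd_psd pA); exists S => //.
suff : A \in unitmx by rewrite defA unitmx_mul => /andP[].
rewrite -unitmx_tr -row_free_unit -kermx_eq0; apply: contraT => K0.
have /rowV0Pn[v /sub_kermxP vA vN0] := K0.
have : A *m v^T = 0 by rewrite -[A]trmxK -trmx_mul vA trmx0.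
have /pA : v^T != 0 by rewrite -trmx0 (inj_eq trmx_inj).
by rewrite -mulmxA => /[swap] ->; rewrite mulmx0 mxE ltxx.
Qed.

(** A crude substitute for the operator norm: a product of the moduli of two entries of [v] is at
    most the squared length of [v]. *)
Lemma form_le n (B : 'M[C]_n) (v : 'cV[C]_n) :
  `|(v ^t* *m B *m v) 0 0| <= (\sum_i \sum_j `|B i j|) * (v ^t* *m v) 0 0.
Proof.
rewrite formE (le_trans (ler_norm_sum _ _ _)) // mulr_suml ler_sum // => i _.
rewrite (le_trans (ler_norm_sum _ _ _)) // mulr_suml ler_sum // => j _.
rewrite !normrM norm_conjC mulrAC mulrC ler_wpM2l //.
have v_ge i1 : `|v i1 0| ^+ 2 <= (v ^t* *m v) 0 0.
  rewrite dotE (bigD1 i1) //= mulrC -normCK lerDl sumr_ge0 // => i2 _.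
  by rewrite mulrC mul_conjC_ge0.
(* The order on [C] is partial, so picking the larger modulus goes through realness. *)
have [le_ij|/ltW le_ij] :=
    real_leP (normr_real (v i 0)) (normr_real (v j 0)).
  by apply: le_trans (v_ge j); rewrite expr2 ler_wpM2r.
by apply: le_trans (v_ge i); rewrite expr2 ler_wpM2l.
Qed.

Lemma herm_form_real n (B : 'M[C]_n) (v : 'cV[C]_n) :
  B ^t* = B -> (v ^t* *m B *m v) 0 0 \is Num.real.
Proof.
move=> hB; apply/CrealP.
by rewrite -[in LHS](trmxCE (v ^t* *m B *m v) 0 0) !trmxCM trmxCK hB mulmxA.
Qed.

(** The congruence by [invmx S] reduces the claim to a perturbation of the identity by a multiple of
    the Hermitian matrix [c], which [form_le] controls. *)
Lemma pd_perturb n (A B : 'M[C]_n) : pd A -> B ^t* = B ->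
  exists2 e : C, 0 < e & pd (A + e *: B) /\ pd (A - e *: B).
Proof.
move=> pA hB; have [S Su ->] := pd_factor pA.
pose c := invmx S *m B *m (invmx S) ^t*.
have hc : c ^t* = c by rewrite /c !trmxCM trmxCK hB mulmxA.
have -> : B = S *m c *m S ^t*.
  by rewrite /c !mulmxA mulmxV // mul1mx -mulmxA -trmxCM mulmxV // trmxC1 mulmx1.
(* Adding 1 keeps the denominator positive when [c = 0] and makes the final estimate strict. *)
pose M := \sum_i \sum_j `|c i j|; pose e := (M + 1)^-1.
have M_ge0 : 0 <= M by do 2![apply: sumr_ge0 => ? _].
have M1_gt0 : 0 < M + 1 by rewrite ltr_wpDl.
exists e; first by rewrite invr_gt0.
suff main (s : bool) : pd (S *m S ^t* + (-1) ^+ s *: (e *: (S *m c *m S ^t*))).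
  by split; [have := main false | have := main true];
     rewrite ?expr0 ?expr1 ?scale1r ?scaleN1r.
have -> : S *m S ^t* + (-1) ^+ s *: (e *: (S *m c *m S ^t*)) =
          S *m (1%:M + ((-1) ^+ s * e) *: c) *m S ^t*.
  by rewrite mulmxDr mulmx1 mulmxDl -scalemxAr -scalemxAl scalerA.
move=> v vN0; set w := S ^t* *m v.
have wN0 : w != 0.
  apply: contraNneq vN0 => w0; have Scu : S ^t* \in unitmx.
    by rewrite map_unitmx unitmx_tr.
  by rewrite -(mulKmx Scu v) -/w w0 mulmx0.
have -> : v ^t* *m (S *m (1%:M + ((-1) ^+ s * e) *: c) *m S ^t*) *m v =
          w ^t* *m (1%:M + ((-1) ^+ s * e) *: c) *m w.
  by rewrite /w trmxCM trmxCK !mulmxA.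
rewrite mulmxDr mulmx1 mulmxDl -scalemxAr -scalemxAl.
rewrite [X in 0 < X]mxE [X in _ + X]mxE.
set q := (w ^t* *m c *m w) 0 0; set p := (w ^t* *m w) 0 0.
have p_gt0 : 0 < p by rewrite dot_gt0.
have qR : q \is Num.real by exact: herm_form_real.
have : `|(-1) ^+ s * e * q| < p.
  rewrite !normrM normrX normrN1 expr1n mul1r ger0_norm ?invr_ge0 ?ltW //.
  rewrite mulrC ltr_pdivrMr // (le_lt_trans (form_le _ _)) // -/M -/p.
  by rewrite mulrC ltr_pM2l // ltrDl.
have eR : (-1) ^+ s * e \is Num.real.
  apply: realM; last by rewrite ger0_real ?invr_ge0 ?ltW.
  by case: (s); rewrite ?expr0 ?expr1 ?realN ?real1.
rewrite real_ltr_norml; last exact: realM.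
case/andP=> + _.
by rewrite -subr_gt0 opprK addrC.
Qed.

(** Hermitian real and imaginary parts. The trace clause splits a traceless direction into traceless
    Hermitian ones. *)
Lemma herm_decomp n (A : 'M[C]_n) :
  exists H1 H2 : 'M[C]_n,
   [/\ H1 ^t* = H1, H2 ^t* = H2, A = H1 + 'i *: H2 &
       (\tr A = 0 -> \tr H1 = 0 /\ \tr H2 = 0)].
Proof.
exists (2^-1 *: (A + A ^t*)), ((- 'i / 2) *: (A - A ^t*)); split.
- by rewrite trmxCZ trmxCD trmxCK addrC fmorphV rmorph_nat.
- rewrite trmxCZ trmxCB trmxCK -opprB scalerN -scaleNr; congr (_ *: _).
  by rewrite rmorphM rmorphN fmorphV rmorph_nat /= conjCi mulNr opprK.
- apply/matrixP => i j; rewrite !mxE -mulrA mulNr mulrN mulrA -expr2 sqrCi.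
  by field.
- have -> : \tr (2^-1 *: (A + A ^t*)) = 2^-1 * (\tr A + (\tr A)^*).
    by rewrite mxtraceZ mxtraceD trace_map_mx mxtrace_tr.
  have -> : \tr ((- 'i / 2) *: (A - A ^t*)) = (- 'i / 2) * (\tr A - (\tr A)^*).
    by rewrite mxtraceZ (linearB (@mxtrace C n)) /= trace_map_mx mxtrace_tr.
  by move=> ->; rewrite rmorph0 addr0 subr0 !mulr0.
Qed.

Lemma trace_form_eq0 n (G : 'M[C]_n) : (forall Y, \tr (G *m Y) = 0) -> G = 0.
Proof.
move=> G0; apply/matrixP => i j; rewrite [RHS]mxE -(G0 (delta_mx j i)).
rewrite -(mul_delta_mx (0 : 'I_1)) mulmxA mxtrace_mulC mulmxA -rowE -colE.
by rewrite /mxtrace big_ord1 !mxE.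
Qed.

(** States span all matrices: positive definite ones by rescaling, a Hermitian [H] through [1 + e H]
    and [1], the others through their Hermitian parts. Size 0 has no state and is settled apart. *)
Lemma state_sep n (G : 'M[C]_n) :
  (forall rho, state rho -> \tr (G *m rho) = 0) -> G = 0.
Proof.
case: n G => [|n] G G0; first by rewrite [G]thinmx0.
have fpd A : pd A -> \tr (G *m A) = 0.
  move=> pA; have trA := pd_trace_gt0 (ltn0Sn n) pA.
  have -> : A = \tr A *: ((\tr A)^-1 *: A).
    by rewrite scalerA divff ?scale1r ?gt_eqF.
  rewrite -scalemxAr mxtraceZ G0 ?mulr0 //; split.
    by apply/pd_psd/pdZ; rewrite ?invr_gt0.
  by rewrite mxtraceZ mulVf ?gt_eqF.
have fh H : H ^t* = H -> \tr (G *m H) = 0.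
  move=> hH; have [e e0 [pe _]] := pd_perturb (@pd1 C _) hH.
  have := fpd _ pe; rewrite mulmxDr mxtraceD fpd; last exact: pd1.
  by rewrite add0r -scalemxAr mxtraceZ => /eqP; rewrite mulf_eq0 gt_eqF //= => /eqP.
apply: trace_form_eq0 => Y; have [H1 [H2 [h1 h2 -> _]]] := herm_decomp Y.
by rewrite mulmxDr -scalemxAr mxtraceD mxtraceZ !fh // mulr0 addr0.
Qed.

End Positive.

(** * Kraus representations *)

Section Channels.
Variable C : numClosedFieldType.

Lemma sum_mxtens (V : nmodType) m n (F : 'I_(m * n) -> V) :
  \sum_p F p = \sum_i \sum_j F (mxtens_index (i, j)).
Proof.
rewrite pair_big (reindex (@mxtens_index m n)) /=; last first.
  by exists (@mxtens_unindex m n) => p _; rewrite (mxtens_indexK, mxtens_unindexK).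
by apply: eq_bigr => -[i j] _.
Qed.

Lemma mxtensP (V : Type) m n p q (A B : 'M[V]_(m * n, p * q)) :
  (forall i a j b, A (mxtens_index (i, a)) (mxtens_index (j, b)) =
                   B (mxtens_index (i, a)) (mxtens_index (j, b))) -> A = B.
Proof.
move=> eqAB; apply/matrixP => x y.
by case: (mxtens_indexP x) => i a; case: (mxtens_indexP y) => j b.
Qed.

Lemma sum_delta (V : pzSemiRingType) n (i : 'I_n) (F : 'I_n -> V) :
  \sum_j (i == j)%:R * F j = F i.
Proof.
rewrite (bigD1 i) //= eqxx mul1r big1 ?addr0 // => j /negPf ji.
by rewrite eq_sym ji mul0r.
Qed.

Lemma mulmx_trmxCE m n p (A : 'M[C]_(m, n)) (B : 'M[C]_(p, n)) i j :
  (A *m B ^t*) i j = ((B *m A ^t*) j i)^*.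
Proof. by rewrite -trmxCE trmxCM trmxCK. Qed.

Lemma psd_conj m n (B : 'M[C]_(m, n)) (Y : 'M[C]_n) :
  psd Y -> psd (B *m Y *m B ^t*).
Proof.
move=> pY v; have := pY (B ^t* *m v).
by rewrite trmxCM trmxCK !mulmxA.
Qed.

Lemma psd_sum n (J : finType) (F : J -> 'M[C]_n) :
  (forall j, psd (F j)) -> psd (\sum_j F j).
Proof.
move=> pF; elim/big_ind: _ => [v||//]; last exact: psdD.
by rewrite mulmx0 mul0mx mxE.
Qed.

Lemma amplE n m k (Phi : 'M[C]_n -> 'M[C]_m) (Y : 'M[C]_(k * n)) s p t q :
  ampl Phi Y (mxtens_index (s, p)) (mxtens_index (t, q)) =
  Phi (\matrix_(a, b) Y (mxtens_index (s, a)) (mxtens_index (t, b))) p q.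
Proof. by rewrite mxE !mxtens_indexK. Qed.

Lemma eq_cp n m (Phi Psi : 'M[C]_n -> 'M[C]_m) :
  Phi =1 Psi -> completely_positive Phi -> completely_positive Psi.
Proof.
move=> eqP cpP k Y pY; have -> : ampl Psi Y = ampl Phi Y; last exact: cpP.
by apply: mxtensP => s p t q; rewrite !amplE eqP.
Qed.

Lemma cp_comp n m l (Phi : 'M[C]_n -> 'M[C]_m) (Psi : 'M[C]_m -> 'M[C]_l) :
  completely_positive Phi -> completely_positive Psi ->
  completely_positive (Psi \o Phi).
Proof.
move=> cp1 cp2 k Y pY; have -> : ampl (Psi \o Phi) Y = ampl Psi (ampl Phi Y).
  apply: mxtensP => s p t q; rewrite !amplE /=; congr (Psi _ p q).
  by apply/matrixP => a b; rewrite [RHS]mxE amplE.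
exact/cp2/cp1.
Qed.

Definition kraus (J : finType) m n (K : J -> 'M[C]_(m, n)) (Y : 'M[C]_n) :=
  \sum_l K l *m Y *m (K l) ^t*.

Lemma kraus_is_linear (J : finType) m n (K : J -> 'M[C]_(m, n)) :
  linear (kraus K).
Proof.
move=> a Y Y'; rewrite /kraus scaler_sumr -big_split; apply: eq_bigr => l _ /=.
by rewrite mulmxDr mulmxDl -scalemxAr -scalemxAl.
Qed.
HB.instance Definition _ (J : finType) m n (K : J -> 'M[C]_(m, n)) :=
  GRing.isLinear.Build C 'M[C]_n 'M[C]_m *:%R (kraus K) (kraus_is_linear K).

Lemma tens1E n m k (A : 'M[C]_(m, n)) s p t q :
  ((1%:M : 'M[C]_k) *t A) (mxtens_index (s, p)) (mxtens_index (t, q)) =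
  (s == t)%:R * A p q.
Proof. by rewrite tensmxE mxE. Qed.

Lemma tens1_mulE n m k l (A : 'M[C]_(m, n)) (Y : 'M[C]_(k * n, l)) s p y :
  (((1%:M : 'M[C]_k) *t A) *m Y) (mxtens_index (s, p)) y =
  \sum_a A p a * Y (mxtens_index (s, a)) y.
Proof.
rewrite mxE sum_mxtens.
rewrite -(sum_delta s (fun t => \sum_a A p a * Y (mxtens_index (t, a)) y)).
apply: eq_bigr => t _; rewrite mulr_sumr; apply: eq_bigr => a _.
by rewrite tens1E mulrA.
Qed.

Lemma trmxC_tens m n p q (A : 'M[C]_(m, n)) (B : 'M[C]_(p, q)) :
  (A *t B) ^t* = A ^t* *t B ^t*.
Proof. by rewrite trmx_tens map_mxT. Qed.

(** The ampliation is again a Kraus map, with operators [1%:M *t K l]. *)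
Lemma kraus_cp (J : finType) m n (K : J -> 'M[C]_(m, n)) :
  completely_positive (kraus K).
Proof.
move=> k Y pY.
have -> : ampl (kraus K) Y =
    \sum_l (1%:M *t K l) *m Y *m ((1%:M : 'M[C]_k) *t K l) ^t*.
  apply: mxtensP => s p t q; rewrite amplE !summxE; apply: eq_bigr => l _.
  rewrite -!mulmxA tens1_mulE mxE; apply: eq_bigr => a _; congr (_ * _).
  rewrite [RHS]mulmx_trmxCE tens1_mulE mxE rmorph_sum; apply: eq_bigr => b _.
  by rewrite rmorphM /= -!trmxCE trmxCK mulrC [X in _ * X]mxE.
by apply: psd_sum => l; apply: psd_conj.
Qed.

(* The map [v |-> v (x) a]. *)
Definition emb d k (a : 'cV[C]_k) : 'M[C]_(d * k, d) :=
  \matrix_(p, j) (((mxtens_unindex p).1 == j)%:R * a (mxtens_unindex p).2 0).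

Lemma embE d k (a : 'cV[C]_k) i s (j : 'I_d) :
  emb d a (mxtens_index (i, s)) j = (i == j)%:R * a s 0.
Proof. by rewrite mxE mxtens_indexK. Qed.

Lemma emb_mulE d k n (a : 'cV[C]_k) (Y : 'M[C]_(d, n)) i s y :
  (emb d a *m Y) (mxtens_index (i, s)) y = a s 0 * Y i y.
Proof.
rewrite mxE -(sum_delta i (fun j => a s 0 * Y j y)); apply: eq_bigr => j _.
by rewrite embE mulrA.
Qed.

Lemma emb_adj_mulE d k n (a : 'cV[C]_k) (Y : 'M[C]_(d * k, n)) i y :
  ((emb d a) ^t* *m Y) i y = \sum_s (a s 0)^* * Y (mxtens_index (i, s)) y.
Proof.
rewrite mxE sum_mxtens.
rewrite -(sum_delta i (fun j => \sum_s (a s 0)^* * Y (mxtens_index (j, s)) y)).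
apply: eq_bigr => j _; rewrite mulr_sumr; apply: eq_bigr => s _.
by rewrite trmxCE embE rmorphM /= conjC_nat mulrA eq_sym.
Qed.

(** Expanding [S *m S ^t*] over the columns of [S] shows that adjoining a positive apparatus
    operator is a Kraus map. *)
Lemma tens_kraus d k n (S : 'M[C]_(k, n)) (rho : 'M[C]_d) :
  rho *t (S *m S ^t*) = kraus (fun t => emb d (col t S)) rho.
Proof.
apply: mxtensP => i s j r; rewrite tensmxE summxE mxE mulr_sumr.
apply: eq_bigr => t _; rewrite -mulmxA emb_mulE mulmx_trmxCE emb_mulE.
by rewrite rmorphM /= -[(_^t* j i)^*]trmxCE trmxCK trmxCE !mxE; ring.
Qed.

(** Dually, the readout of a positive apparatus operator contracts the apparatus with the columns of
    [Q]. *)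
Lemma ptrA_kraus d k n (Q : 'M[C]_(k, n)) (Y : 'M[C]_(d * k)) :
  ptrA ((1%:M *t (Q *m Q ^t*)) *m Y) = kraus (fun t => (emb d (col t Q)) ^t*) Y.
Proof.
apply/matrixP => i j; rewrite mxE summxE.
transitivity (\sum_t \sum_a \sum_b
   Q a t * (Q b t)^* * Y (mxtens_index (i, b)) (mxtens_index (j, a))).
  rewrite exchange_big; apply: eq_bigr => a _; rewrite tens1_mulE exchange_big.
  apply: eq_bigr => b _; rewrite mxE mulr_suml; apply: eq_bigr => t _.
  by rewrite trmxCE.
apply: eq_bigr => t _; rewrite mulmx_trmxCE emb_adj_mulE rmorph_sum.
apply: eq_bigr => a _; rewrite rmorphM /= trmxCE !conjCK emb_adj_mulE mulr_sumr.
by apply: eq_bigr => b _; rewrite !mxE mulrA.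
Qed.

(** The Choi matrix factors as [W *m W ^t*] with independent columns, which reshape into Kraus
    operators. The second clause is the independence of the maps [Y |-> K_i Y K_j^*], the form
    needed against extremality. *)
Lemma choi_kraus n m (Phi : {linear 'M[C]_n -> 'M[C]_m}) :
  completely_positive Phi ->
  exists N (K : 'I_N -> 'M[C]_(m, n)), Phi =1 kraus K /\
    forall c : 'M[C]_N,
      (forall Y, \sum_i \sum_j c i j *: (K i *m Y *m (K j) ^t*) = 0) -> c = 0.
Proof.
move=> cpPhi.
(* The unnormalized maximally entangled vector, so that [J] is the Choi matrix. *)
pose w : 'cV[C]_(n * n) :=
  \col_p ((mxtens_unindex p).1 == (mxtens_unindex p).2)%:R.
pose J : 'M[C]_(n * m) := ampl Phi (w *m w ^t*).
have JE i p j q : J (mxtens_index (i, p)) (mxtens_index (j, q)) =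
                  Phi (delta_mx i j) p q.
  rewrite amplE; congr (Phi _ p q); apply/matrixP => a b.
  rewrite !mxE big_ord1 !mxE !mxtens_indexK /= conjC_nat -natrM mulnb.
  by rewrite eq_sym [j == b]eq_sym.
have pJ : psd J by apply/cpPhi/psd_gram.
have [N [W [Wfree defJ]]] : exists N (W : 'M[C]_(n * m, N)),
    row_free W^T /\ J = W *m W ^t*.
  (* The square factor [S] may have dependent columns. With the rank factorization [S = L B] and
     [B B^* = T T^*] for an invertible [T], the columns of [L T] are independent and [L T] still
     factors [J]. *)
  have [S defJ] := psd_factor pJ; set L := col_base S; set B := row_base S.
  have pB : pd (B *m B ^t*).
    move=> v vN0; rewrite gram_form dot_gt0 //; apply: contraNneq vN0 => Bv0.
    have : v ^t* *m B = 0.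
      by rewrite -[LHS]trmxCK trmxCM trmxCK Bv0 trmx0 map_mx0.
    move/eqP; rewrite mulmx_free_eq0 ?row_base_free // => /eqP v0.
    by rewrite -[v]trmxCK v0 trmx0 map_mx0.
  have [T Tu defT] := pd_factor pB.
  exists (\rank S), (L *m T); split.
    rewrite trmx_mul /row_free mxrankMfree ?mxrank_tr.
      by rewrite mxrank_unit.
    by rewrite /row_free mxrank_tr; apply: col_base_full.
  by rewrite trmxCM mulmxA -(mulmxA L) -defT mulmxA mulmx_base -mulmxA
             -trmxCM mulmx_base.
(* Each column of [W] reshapes into a Kraus operator; freeness of the columns
   gives independence. *)
pose K (l : 'I_N) : 'M[C]_(m, n) := \matrix_(p, i) W (mxtens_index (i, p)) l.
have KE i j a b p q : (K i *m delta_mx a b *m (K j) ^t*) p q =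
    W (mxtens_index (a, p)) i * (W (mxtens_index (b, q)) j)^*.
  rewrite -(mul_delta_mx (0 : 'I_1)) !mulmxA -colE -mulmxA -rowE mxE big_ord1.
  by rewrite !mxE.
exists N, K; split=> [Y|c c0].
  rewrite (matrix_sum_delta Y) !linear_sum; apply: eq_bigr => a _.
  rewrite !linear_sum; apply: eq_bigr => b _; rewrite !linearZ /=.
  congr (_ *: _).
  apply/matrixP => p q; rewrite -JE defJ mxE summxE; apply: eq_bigr => l _.
  by rewrite KE trmxCE.
(* On matrix units the hypothesis reads [W c W^* = 0]; injectivity of [W] cancels the left factor
   and, after an adjoint, the right one. *)
have W0 : W *m c *m W ^t* = 0.
  apply: mxtensP => a p b q; rewrite mxE [RHS]mxE.
  have /matrixP/(_ p q) := c0 (delta_mx a b).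
  rewrite [RHS]mxE; apply: etrans; rewrite summxE.
  under [RHS]eq_bigr => i _ do rewrite summxE.
  rewrite [RHS]exchange_big /=; apply: eq_bigr => j _.
  rewrite mxE mulr_suml; apply: eq_bigr => i _.
  by rewrite [RHS]mxE KE trmxCE mulrA [c _ _ * _]mulrC.
have Winj l (X : 'M[C]_(N, l)) : W *m X = 0 -> X = 0.
  move=> WX0; apply: trmx_inj; apply/eqP; rewrite trmx0.
  by rewrite -(mulmx_free_eq0 _ Wfree) -trmx_mul WX0 trmx0.
have : W *m c ^t* = 0.
  rewrite -[LHS]trmxCK trmxCM trmxCK (Winj _ (c *m W ^t*)) ?mulmxA //.
  by rewrite trmx0 map_mx0.
by move/Winj => c_eq0; rewrite -[c]trmxCK c_eq0 trmx0 map_mx0.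
Qed.


End Channels.

(** * The rank bound *)

Section RankBound.
Variable C : numClosedFieldType.

(** Dimension count: [f] goes from dimension [m^2] to the smaller dimension [n^2]. *)
Lemma lin_kernel m n (f : {linear 'M[C]_m -> 'M[C]_n}) : (n < m)%N ->
  exists2 c, c != 0 & f c = 0.
Proof.
move=> ltnm; have : kermx (lin_mx f) != 0.
  rewrite kermx_eq0 /row_free neq_ltn (leq_ltn_trans (rank_leq_col _)) //.
  by rewrite ltn_mul.
case/rowV0Pn => v /sub_kermxP vf0 vN0; exists (vec_mx v).
  by apply: contraNneq vN0 => v0; rewrite -[v]vec_mxK v0 linear0.
by apply: (can_inj mxvecK); rewrite -mul_vec_lin vec_mxK vf0 linear0.
Qed.

Lemma lin_inj_surj n (f : {linear 'M[C]_n -> 'M[C]_n}) :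
  (forall B, f B = 0 -> B = 0) -> forall Y, exists B, f B = Y.
Proof.
move=> finj; have fu : row_free (lin_mx f).
  rewrite -kermx_eq0; apply: contraT => /rowV0Pn[v /sub_kermxP vf0 /negP[]].
  rewrite -[v]vec_mxK (finj (vec_mx v)) ?linear0 //.
  by apply: (can_inj mxvecK); rewrite -mul_vec_lin vec_mxK vf0 linear0.
move=> Y; exists (vec_mx (mxvec Y *m invmx (lin_mx f))).
apply: (can_inj mxvecK); rewrite -mul_vec_lin vec_mxK mulmxKV //.
by rewrite -row_free_unit.
Qed.

Lemma trace_gram m n (M : 'M[C]_(m, n)) :
  \tr (M ^t* *m M) = \sum_j \sum_i `|M i j| ^+ 2.
Proof.
rewrite /mxtrace; apply: eq_bigr => j _; rewrite mxE; apply: eq_bigr => i _.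
by rewrite trmxCE mulrC -normCK.
Qed.

Lemma trace_gram_ge0 m n (M : 'M[C]_(m, n)) : 0 <= \tr (M ^t* *m M).
Proof.
by rewrite trace_gram; do 2![apply: sumr_ge0 => ? _]; rewrite exprn_ge0.
Qed.

Lemma trace_gram_eq0 m n (M : 'M[C]_(m, n)) : \tr (M ^t* *m M) = 0 -> M = 0.
Proof.
rewrite trace_gram => /eqP; rewrite psumr_eq0 => [/allP M0|j _]; last first.
  by apply: sumr_ge0 => ? _; rewrite exprn_ge0.
apply/matrixP => i j; have := M0 j (mem_index_enum _).
rewrite /= psumr_eq0 => [/allP/(_ i (mem_index_enum _))|? _]; last first.
  by rewrite exprn_ge0.
by rewrite /= expf_eq0 normr_eq0 mxE => /eqP.
Qed.

Definition kraus_effect N m n (K : 'I_N -> 'M[C]_(m, n)) : 'M[C]_n :=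
  \sum_i (K i) ^t* *m K i.

(** On the kernel of the effect the squared norms of the [K l] sum to zero, so each [K i] vanishes
    there; inclusion of row spaces is the dual form. *)
Lemma kraus_submx N m n (K : 'I_N -> 'M[C]_(m, n)) i :
  (K i <= kraus_effect K)%MS.
Proof.
set E := kraus_effect K; rewrite submxE; set X := cokermx E.
have : \tr (\sum_l (K l *m X) ^t* *m (K l *m X)) = 0.
  have -> : \sum_l (K l *m X) ^t* *m (K l *m X) = X ^t* *m (E *m X).
    rewrite /E mulmx_suml mulmx_sumr; apply: eq_bigr => l _.
    by rewrite trmxCM !mulmxA.
  by rewrite mulmx_coker mulmx0 mxtrace0.
rewrite linear_sum /= => /eqP; rewrite psumr_eq0 => [|l _]; last first.
  exact: trace_gram_ge0.
move=> /allP/(_ i (mem_index_enum _)) /= /eqP/trace_gram_eq0 ->.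
by [].
Qed.

(** The trace of its product with [Y] is that of [\sum_ij c_ij K_i Y K_j^*], whence the swapped
    indices; when it is zero, adding that sum to the Kraus map leaves the effect unchanged. *)
Definition kraus_gram N m n (K : 'I_N -> 'M[C]_(m, n)) (c : 'M[C]_N) :=
  \sum_i \sum_j c i j *: ((K j) ^t* *m K i).

Lemma kraus_gram_is_linear N m n (K : 'I_N -> 'M[C]_(m, n)) :
  linear (kraus_gram K).
Proof.
move=> a c c'; rewrite /kraus_gram scaler_sumr -big_split.
apply: eq_bigr => i _ /=; rewrite scaler_sumr -big_split; apply: eq_bigr => j _ /=.
by rewrite !mxE scalerDl scalerA.
Qed.
HB.instance Definition _ N m n (K : 'I_N -> 'M[C]_(m, n)) :=
  GRing.isLinear.Build C 'M[C]_N 'M[C]_n *:%R (kraus_gram K)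
    (kraus_gram_is_linear K).

(** Makes the kernel of [kraus_gram K] stable under adjoints, so that Hermitian relations can be
    extracted. *)
Lemma kraus_gram_adj N m n (K : 'I_N -> 'M[C]_(m, n)) c :
  kraus_gram K (c ^t*) = (kraus_gram K c) ^t*.
Proof.
rewrite /kraus_gram trmxC_sum exchange_big; apply: eq_bigr => i _.
rewrite trmxC_sum; apply: eq_bigr => j _.
by rewrite trmxCZ trmxCM trmxCK trmxCE.
Qed.

(** Factoring each [K i] through [row_base E] turns the products into [r] by [r] matrices, with [r]
    the rank of the effect; then [N^2 > r^2] coefficients admit a nonzero relation. *)
Lemma kraus_dependent N m n (K : 'I_N -> 'M[C]_(m, n)) :
  (\rank (kraus_effect K) < N)%N ->
  exists c : 'M[C]_N, [/\ c != 0, c ^t* = c & kraus_gram K c = 0].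
Proof.
set E := kraus_effect K => ltEN.
have sK i : exists B, K i == B *m row_base E.
  have /submxP[B ->] : (K i <= row_base E)%MS.
    by rewrite eq_row_base kraus_submx.
  by exists B.
pose B i := xchoose (sK i).
have KB i : K i = B i *m row_base E := eqP (xchooseP (sK i)).
have [c cN0 Bc0] := lin_kernel (kraus_gram B) ltEN.
have Kc0 : kraus_gram K c = 0.
  transitivity ((row_base E) ^t* *m kraus_gram B c *m row_base E).
    rewrite /kraus_gram mulmx_sumr mulmx_suml; apply: eq_bigr => i _.
    rewrite mulmx_sumr mulmx_suml; apply: eq_bigr => j _.
    by rewrite -scalemxAr -scalemxAl !KB trmxCM !mulmxA.
  by rewrite [kraus_gram B c]Bc0 mulmx0 mul0mx.
(* Taking the adjoint of the relation shows that both Hermitian parts of [c] are relations; one of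
   them is nonzero. *)
have [H1 [H2 [h1 h2 defc _]]] := herm_decomp c.
have [G1 G2] : kraus_gram K H1 = 0 /\ kraus_gram K H2 = 0.
  have E1 : kraus_gram K H1 + 'i *: kraus_gram K H2 = 0.
    by rewrite -[RHS]Kc0 defc linearD linearZ.
  have E2 : kraus_gram K H1 - 'i *: kraus_gram K H2 = 0.
    have := congr1 (fun M => M ^t*) E1.
    by rewrite trmxCD trmxCZ -!kraus_gram_adj h1 h2 conjCi scaleNr trmx0
               map_mx0.
  have G1 : kraus_gram K H1 = 0.
    have := congr2 +%R E1 E2; rewrite addrACA subrr !addr0 -mulr2n => /eqP.
    by rewrite -scaler_nat scaler_eq0 pnatr_eq0 => /eqP.
  split=> //; move/eqP: E1.
  by rewrite G1 add0r scaler_eq0 (negPf (neq0Ci _)) => /eqP.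
have [H10|H1N0] := eqVneq H1 0; last by exists H1.
exists H2; split=> //; apply: contraNneq cN0 => H20.
by rewrite defc H10 H20 scaler0 addr0.
Qed.

(** Each of the [N] summands [K_i K_i^*] has rank at most that of [K i], whose row space lies in
    that of the effect. *)
Lemma rank_kraus1 N n (K : 'I_N -> 'M[C]_n) :
  (\rank (kraus K 1%:M) <= N * \rank (kraus_effect K))%N.
Proof.
set E := kraus_effect K.
have -> : (N * \rank E = \sum_(i < N) \rank E)%N.
  by rewrite sum_nat_const card_ord.
rewrite /kraus; elim/big_ind2: _ => [|A a B b leA leB|i _].
- by rewrite mxrank0.
- by rewrite (leq_trans (mxrank_add _ _)) // leq_add.
- by rewrite -mulmxA (leq_trans (mxrankM_maxl _ _)) // mxrankS // kraus_submx.
Qed.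

(** Recombining the operators by the columns of [S] replaces the coefficient matrix [1] by
    [S *m S ^t*], so every positive coefficient matrix yields a completely positive map. *)
Lemma kraus_mix N m n (K : 'I_N -> 'M[C]_(m, n)) (S : 'M[C]_N) Y :
  kraus (fun l => \sum_i S i l *: K i) Y =
  \sum_i \sum_j (S *m S ^t*) i j *: (K i *m Y *m (K j) ^t*).
Proof.
transitivity
  (\sum_l \sum_i \sum_j (S i l * (S j l)^*) *: (K i *m Y *m (K j) ^t*)).
  apply: eq_bigr => l _; rewrite !mulmx_suml; apply: eq_bigr => i _.
  rewrite trmxC_sum mulmx_sumr; apply: eq_bigr => j _.
  by rewrite trmxCZ -!scalemxAl -scalemxAr scalerA.
rewrite exchange_big; apply: eq_bigr => i _; rewrite exchange_big.
apply: eq_bigr => j _; rewrite -scaler_suml mxE; congr (_ *: _).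
by apply: eq_bigr => l _; rewrite trmxCE.
Qed.

Lemma extremal_independent d (X : finType)
    (I : X -> {linear 'M[C]_d -> 'M[C]_d}) x N
    (K : 'I_N -> 'M[C]_d) :
  instrument I -> extremal_instrument I -> I x =1 kraus K ->
  (forall c : 'M[C]_N,
      (forall Y, \sum_i \sum_j c i j *: (K i *m Y *m (K j) ^t*) = 0) -> c = 0) ->
  forall c : 'M[C]_N, c ^t* = c -> kraus_gram K c = 0 -> c = 0.
Proof.
move=> [cpI trI] extI IK freeK c hc Gc0.
have [e e_gt0 [p1 p2]] := pd_perturb (@pd1 C N) hc.
pose T Y := \sum_i \sum_j c i j *: (K i *m Y *m (K j) ^t*).
have trT Y : \tr (T Y) = 0.
  have -> : \tr (T Y) = \tr (kraus_gram K c *m Y).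
    rewrite mulmx_suml !linear_sum; apply: eq_bigr => i _ /=.
    rewrite mulmx_suml !linear_sum; apply: eq_bigr => j _ /=.
    by rewrite -scalemxAl !mxtraceZ mxtrace_mulC mulmxA.
  by rewrite Gc0 mul0mx mxtrace0.
have mix (a : C) : pd (1%:M + a *: c) ->
    exists L : 'I_N -> 'M[C]_d, forall Y, kraus L Y = I x Y + a *: T Y.
  case/pd_factor => S _ defS; exists (fun l => \sum_i S i l *: K i) => Y.
  rewrite kraus_mix -defS IK /kraus /T scaler_sumr -big_split.
  apply: eq_bigr => i _ /=.
  (* Only the coefficient with [j = i] receives a contribution from the identity. *)
  rewrite (bigD1 i) //= scaler_sumr [X in _ = _ + X](bigD1 i) //= addrA.
  rewrite !mxE eqxx scalerDl scale1r -!scalerA; congr (_ + _).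
  apply: eq_bigr => j /negPf ji.
  by rewrite !mxE eq_sym ji add0r -!scalerA.
(* Only outcome [x] is altered; as [T] is traceless, the total stays trace-preserving. *)
have inst a (L : _ -> _) : (forall Y, kraus L Y = I x Y + a *: T Y) ->
    instrument (fun y => if y == x then kraus L : {linear _ -> _} else I y).
  move=> defL; split=> [y|Y].
    by case: ifP => // _; apply: kraus_cp.
  rewrite -trI !linear_sum; apply: eq_bigr => y _ /=.
  case: eqP => // ->; rewrite /= defL.
  by rewrite mxtraceD mxtraceZ trT mulr0 addr0.
have [L1 defL1] := mix e p1.
rewrite -scaleNr in p2; have [L2 defL2] := mix (- e) p2.
have half : (0 : C) < (2^-1 : C) < 1.
  by rewrite invr_gt0 ltr0n invf_lt1 ?ltr0n // ltr1n.
have [|eqI _] := extI _ _ _ half (inst _ _ _ defL1) (inst _ _ _ defL2).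
  have e2 : (1 - 2^-1 : C) = 2^-1 by field.
  move=> y Y; rewrite e2 -scalerDr; case: eqP => [->|_].
    rewrite /= defL1 defL2 scaleNr addrACA subrr addr0.
    by rewrite -mulr2n -scaler_nat scalerA mulVf ?scale1r // pnatr_eq0.
  by rewrite -mulr2n -scaler_nat scalerA mulVf ?scale1r // pnatr_eq0.
apply: freeK => Y; have := eqI x Y; rewrite eqxx /= defL1 => /eqP.
by rewrite -subr_eq0 addrAC subrr add0r scaler_eq0 gt_eqF //= => /eqP.
Qed.

(** With [r] the rank of [E x], the chain is [d <= N r <= r^2]: the first step is the rank of the
    invertible [I x 1%:M], the second holds because more than [r] Kraus operators would satisfy a
    forbidden Hermitian relation. *)
Lemma sqrt_dim_le_rank d (X : finType) (I : X -> {linear 'M[C]_d -> 'M[C]_d})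
    (E : X -> 'M[C]_d) x :
  E_instrument E I -> instrument I -> extremal_instrument I ->
  I x 1%:M \in unitmx -> (d <= \rank (E x) ^ 2)%N.
Proof.
move=> [cpI trI] instI extI unitI.
have [N [K [IK freeK]]] := choi_kraus (cpI x).
have defE : E x = kraus_effect K.
  apply/eqP; rewrite -subr_eq0; apply/eqP/state_sep => rho st.
  rewrite mulmxBl linearB /= -trI // IK /kraus_effect mulmx_suml !linear_sum.
  rewrite -sumrB /=.
  by apply: big1 => l _; rewrite mxtrace_mulC mulmxA subrr.
have leNr : (N <= \rank (E x))%N.
  rewrite leqNgt; apply/negP; rewrite defE.
  case/kraus_dependent => [c [/eqP cN0 hc Gc0]].
  exact/cN0/(extremal_independent instI extI IK freeK).
rewrite -[X in (X <= _)%N](mxrank_unit unitI) IK (leq_trans (rank_kraus1 K)) //.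
by rewrite -defE expnS expn1 leq_mul2r leNr orbT.
Qed.

End RankBound.

(** * Measurement schemes *)

Section Schemes.
Variable C : numClosedFieldType.

Lemma ptrA_is_linear d k : linear (@ptrA C d k).
Proof.
move=> a Y Y'; apply/matrixP => i j; rewrite !mxE mulr_sumr -big_split.
by apply: eq_bigr => s _; rewrite !mxE.
Qed.
HB.instance Definition _ d k :=
  GRing.isLinear.Build C 'M[C]_(d * k) 'M[C]_d *:%R (@ptrA C d k)
    (@ptrA_is_linear d k).

Lemma tens_linear_l m n p q (B : 'M[C]_(p, q)) :
  linear (fun A : 'M[C]_(m, n) => A *t B).
Proof.
move=> a A A'; apply: mxtensP => i s j r.
by rewrite tensmxE !mxE !mxtens_indexK /= mulrDl mulrA.
Qed.

Lemma tens_linear_r m n p q (A : 'M[C]_(m, n)) :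
  linear (fun B : 'M[C]_(p, q) => A *t B).
Proof.
move=> a B B'; apply: mxtensP => i s j r.
by rewrite tensmxE !mxE !mxtens_indexK /= mulrDr mulrCA.
Qed.

(** Here [sigma] is any matrix, so that differences of apparatus states can be inserted. *)
Definition scheme_map d k (Ch : {linear 'M[C]_(d * k) -> 'M[C]_(d * k)})
    (Z sigma : 'M[C]_k) (rho : 'M[C]_d) :=
  ptrA ((1%:M *t Z) *m Ch (rho *t sigma)).

Lemma scheme_map_is_linear d k Ch Z sigma : linear (@scheme_map d k Ch Z sigma).
Proof.
move=> a r r'; rewrite /scheme_map (tens_linear_l _ a r r') linearP.
by rewrite mulmxDr -scalemxAr linearP.
Qed.
HB.instance Definition _ d k Ch Z sigma :=
  GRing.isLinear.Build C 'M[C]_d 'M[C]_d *:%R (@scheme_map d k Ch Z sigma)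
    (@scheme_map_is_linear d k Ch Z sigma).

Lemma scheme_mapP d k Ch Z rho a sigma tau :
  @scheme_map d k Ch Z (a *: sigma + tau) rho =
  a *: scheme_map Ch Z sigma rho + scheme_map Ch Z tau rho.
Proof.
by rewrite /scheme_map (tens_linear_r rho a sigma tau) linearP mulmxDr
           -scalemxAr linearP.
Qed.

(** Composition of three completely positive maps: adjoining the apparatus, the interaction [Ch],
    and the readout. *)
Lemma scheme_map_cp d k (Ch : {linear 'M[C]_(d * k) -> 'M[C]_(d * k)}) Z sigma :
  completely_positive Ch -> psd Z -> psd sigma ->
  completely_positive (scheme_map Ch Z sigma).
Proof.
move=> cpCh /psd_factor[Q ->] /psd_factor[S ->].
apply: (@eq_cp _ _ _ (kraus (fun t => (emb d (col t Q)) ^t*) \o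
                      (Ch \o kraus (fun t => emb d (col t S))))).
  by move=> rho; rewrite /scheme_map ptrA_kraus tens_kraus.
by apply: cp_comp; [apply: cp_comp => //|]; apply: kraus_cp.
Qed.

Lemma trace_tens m n (A : 'M[C]_m) (B : 'M[C]_n) : \tr (A *t B) = \tr A * \tr B.
Proof.
rewrite /mxtrace sum_mxtens mulr_suml; apply: eq_bigr => i _.
by rewrite mulr_sumr; apply: eq_bigr => s _; rewrite tensmxE.
Qed.

Lemma trace_ptrA d k (Y : 'M[C]_(d * k)) : \tr (ptrA Y) = \tr Y.
Proof. by rewrite /mxtrace sum_mxtens; apply: eq_bigr => i _; rewrite mxE. Qed.

(** Duality between the partial trace and [B |-> B (x) 1], the passage to the Heisenberg picture. *)
Lemma trace_mul_ptrA d k (B : 'M[C]_d) (Z : 'M[C]_k) (Y : 'M[C]_(d * k)) :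
  \tr (B *m ptrA ((1%:M *t Z) *m Y)) = \tr ((B *t Z) *m Y).
Proof.
have -> : B *t Z = (B *t 1%:M) *m (1%:M *t Z).
  by rewrite tensmx_mul mulmx1 mul1mx.
rewrite -mulmxA; move: ((1%:M *t Z) *m Y) => X; rewrite /mxtrace sum_mxtens.
apply: eq_bigr => i _; rewrite mxE.
under [RHS]eq_bigr => s _ do rewrite mxE sum_mxtens.
rewrite exchange_big; apply: eq_bigr => j _; rewrite mxE mulr_sumr.
apply: eq_bigr => s _; rewrite -(sum_delta s (fun r =>
  B i j * X (mxtens_index (j, r)) (mxtens_index (i, s)))).
by apply: eq_bigr => r _; rewrite tensmxE [1%:M _ _]mxE mulrA [_ * B i j]mulrC.
Qed.

Lemma sum_tens1 (X : finType) d k (Z : X -> 'M[C]_k) (B : 'M[C]_d) :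
  \sum_x Z x = 1%:M -> \sum_x B *t Z x = B *t 1%:M.
Proof.
move=> <-; apply: mxtensP => i s j r; rewrite summxE tensmxE summxE mulr_sumr.
by apply: eq_bigr => x _; rewrite tensmxE.
Qed.

Lemma tens11 m n : (1%:M : 'M[C]_m) *t (1%:M : 'M[C]_n) = 1%:M.
Proof.
apply: mxtensP => i s j r; rewrite tensmxE !mxE -natrM mulnb.
by rewrite (can_eq (@mxtens_indexK m n)) xpair_eqE.
Qed.

(** Summed over outcomes the readout becomes the identity, so trace preservation comes from [Ch] and
    [\tr sigma = 1]. *)
Lemma scheme_map_instrument (X : finType) d k xi sigma
    (Ch : {linear 'M[C]_(d * k) -> 'M[C]_(d * k)}) (Z : X -> 'M[C]_k) :
  measurement_scheme xi Ch Z -> psd sigma -> \tr sigma = 1 ->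
  instrument (fun x => scheme_map Ch (Z x) sigma : {linear _ -> _}).
Proof.
move=> [_ [cpCh trCh] pZ sumZ] psig trsig; split=> [x|Y].
  exact: scheme_map_cp.
rewrite /= /scheme_map -linear_sum -mulmx_suml sum_tens1 // tens11 mul1mx /=.
by rewrite trace_ptrA trCh trace_tens trsig mulr1.
Qed.

(* Moving the apparatus state along a traceless Hermitian direction exhibits [I]
   as the midpoint of two instruments, so extremality forbids any change. *)
Lemma extremal_apparatus_free (X : finType) d k xi
    (Ch : {linear 'M[C]_(d * k) -> 'M[C]_(d * k)}) (Z : X -> 'M[C]_k)
    (I : X -> {linear 'M[C]_d -> 'M[C]_d}) :
  measurement_scheme xi Ch Z -> pd xi -> implements xi Ch Z I ->
  extremal_instrument I ->
  forall x D rho, \tr D = 0 -> scheme_map Ch (Z x) D rho = 0.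
Proof.
move=> ms pxi impl extI x D rho trD; have [[_ trxi] _ _ _] := ms.
have herm H : H ^t* = H -> \tr H = 0 -> scheme_map Ch (Z x) H rho = 0.
  move=> hH trH; have [e e_gt0 [p1 p2]] := pd_perturb pxi hH.
  rewrite addrC in p1; rewrite addrC -scaleNr in p2.
  have inst (a : C) : pd (a *: H + xi) ->
      instrument (fun x => scheme_map Ch (Z x) (a *: H + xi) : {linear _ -> _}).
    move=> pa; apply: (scheme_map_instrument ms); first exact: pd_psd.
    by rewrite mxtraceD mxtraceZ trH mulr0 add0r.
  have half : (0 : C) < (2^-1 : C) < 1.
    by rewrite invr_gt0 ltr0n invf_lt1 ?ltr0n // ltr1n.
  have [|eqI _] := extI _ _ _ half (inst _ p1) (inst _ p2).
    have e2 : (1 - 2^-1 : C) = 2^-1 by field.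
    move=> y Y; rewrite e2 -scalerDr /= !scheme_mapP scaleNr.
    rewrite addrACA subrr add0r.
    rewrite -mulr2n -scaler_nat scalerA mulVf ?scale1r ?pnatr_eq0 //.
    exact: impl.
  have /eqP := eqI x rho; rewrite /= scheme_mapP impl -subr_eq0 addrK.
  by rewrite scaler_eq0 gt_eqF //= => /eqP.
(* Linearity in the apparatus argument extends the claim from Hermitian to all traceless
   directions. *)
have [H1 [H2 [h1 h2 defD /(_ trD)[t1 t2]]]] := herm_decomp D.
by rewrite defD addrC scheme_mapP !herm // scaler0 addr0.
Qed.

(** * Full rank under the third law *)

Lemma pd_tens1 d k (xi : 'M[C]_k) : pd xi -> pd ((1%:M : 'M[C]_d) *t xi).
Proof.
case/pd_factor => S Su ->.
have -> : 1%:M *t (S *m S ^t*) = ((1%:M : 'M[C]_d) *t S) *m (1%:M *t S) ^t*.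
  by rewrite trmxC_tens tensmx_mul trmxC1 mulmx1.
have : ((1%:M : 'M[C]_d) *t S) *m (1%:M *t invmx S) = 1%:M.
  by rewrite tensmx_mul mulmx1 mulmxV // tens11.
by case/mulmx1_unit => S1u _; apply: pd_gram.
Qed.

(** Homogeneity removes the unit-trace normalization, so that the third law applies to
    [1%:M *t xi]. *)
Lemma third_law_pd n m (Phi : {linear 'M[C]_n -> 'M[C]_m}) A : (0 < n)%N ->
  third_law_channel Phi -> pd A -> pd (Phi A).
Proof.
move=> n_gt0 tl pA; have trA := pd_trace_gt0 n_gt0 pA.
have [|pPhi _] := tl ((\tr A)^-1 *: A).
  by split; [apply: pdZ; rewrite ?invr_gt0 | rewrite mxtraceZ mulVf ?gt_eqF].
have -> : Phi A = \tr A *: Phi ((\tr A)^-1 *: A).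
  by rewrite linearZ /= scalerA divff ?scale1r ?gt_eqF.
exact: pdZ.
Qed.

(** A nonzero column [q] of the factor of [Z] sends [v] to the nonzero vector [v (x) q], on which
    [M] is strictly positive; the other Kraus terms are nonnegative. *)
Lemma ptrA_pd d k (Z : 'M[C]_k) (M : 'M[C]_(d * k)) :
  psd Z -> Z != 0 -> pd M -> pd (ptrA ((1%:M *t Z) *m M)).
Proof.
move=> /psd_factor[Q ->] ZN0 pM v vN0; rewrite ptrA_kraus /kraus.
have QN0 : Q != 0 by apply: contraNneq ZN0 => ->; rewrite mul0mx.
have /matrix0Pn[s [t Qst]] := QN0; have /cV0Pn[i vi] := vN0.
have term r (V := emb d (col r Q)) :
    v ^t* *m (V ^t* *m M *m (V ^t*) ^t*) *m v = (V *m v) ^t* *m M *m (V *m v).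
  by rewrite trmxCK trmxCM !mulmxA.
rewrite mulmx_sumr mulmx_suml summxE (bigD1 t) //= ltr_pwDl //.
  rewrite term pM //; apply/eqP => /matrixP/(_ (mxtens_index (i, s)) 0)/eqP.
  by rewrite emb_mulE !mxE mulf_eq0 (negPf Qst) (negPf vi).
by apply: sumr_ge0 => r _; rewrite term; apply: pd_psd.
Qed.

Lemma pd_unit n (A : 'M[C]_n) : pd A -> A \in unitmx.
Proof.
case/pd_factor => S Su ->; rewrite unitmx_mul Su.
by rewrite map_unitmx unitmx_tr.
Qed.

(** * Unitary channels *)

(** For fixed system indices, the apparatus block of [G] is annihilated by all traceless matrices
    and is therefore scalar; [s] is a reference index at which that scalar is read. *)
Lemma apparatus_scalar d k (G : 'M[C]_(d * k)) (s : 'I_k) :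
  (forall rho D, \tr D = 0 -> \tr (G *m (rho *t D)) = 0) ->
  G = (\matrix_(i, j) G (mxtens_index (i, s)) (mxtens_index (j, s))) *t 1%:M.
Proof.
move=> G0; apply: mxtensP => i a j b; rewrite tensmxE !mxE.
have trG (D : 'M[C]_k) : \tr (G *m (delta_mx j i *t D)) =
    \sum_a \sum_b G (mxtens_index (i, a)) (mxtens_index (j, b)) * D b a.
  rewrite /mxtrace sum_mxtens -(sum_delta i (fun l => \sum_a \sum_b
    G (mxtens_index (l, a)) (mxtens_index (j, b)) * D b a)).
  apply: eq_bigr => l _; rewrite mulr_sumr; apply: eq_bigr => r _.
  rewrite mxE sum_mxtens mulr_sumr exchange_big; apply: eq_bigr => t _.
  rewrite -(sum_delta j (fun j' => (i == l)%:R *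
    (G (mxtens_index (l, r)) (mxtens_index (j', t)) * D t r))).
  apply: eq_bigr => j' _; rewrite tensmxE mxE -mulnb natrM.
  by rewrite eq_sym [l == i]eq_sym; ring.
have trD a' b' : \sum_a \sum_b
    G (mxtens_index (i, a)) (mxtens_index (j, b)) *
      (delta_mx b' a' : 'M[C]_k) b a =
    G (mxtens_index (i, a')) (mxtens_index (j, b')).
  rewrite -(sum_delta a' (fun a =>
    G (mxtens_index (i, a)) (mxtens_index (j, b')))).
  apply: eq_bigr => r _; rewrite -(sum_delta b' (fun t => (a' == r)%:R *
    G (mxtens_index (i, r)) (mxtens_index (j, t)))).
  by apply: eq_bigr => t _; rewrite mxE -mulnb natrM eq_sym [r == a']eq_sym;
    ring.
(* This traceless direction compares the entry at [(a, b)] with the reference entry at [(s, s)] when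
   [a = b], and isolates an off-diagonal entry otherwise. *)
have := G0 (delta_mx j i) (delta_mx b a - (b == a)%:R *: delta_mx s s).
have trd (p q : 'I_k) : \tr (delta_mx p q : 'M[C]_k) = (p == q)%:R.
  rewrite -(sum_delta q (fun l => (p == l)%:R)); apply: eq_bigr => l _.
  by rewrite mxE -mulnb natrM mulrC eq_sym [l == p]eq_sym.
rewrite linearB linearZ /= !trd eqxx mulr1 subrr => /(_ erefl).
have -> : (delta_mx j i : 'M[C]_d) *t
            (delta_mx b a - (b == a)%:R *: delta_mx s s : 'M[C]_k) =
          (- (b == a)%:R) *: (delta_mx j i *t delta_mx s s) +
            delta_mx j i *t delta_mx b a.
  by rewrite addrC -scaleNr -(tens_linear_r (delta_mx j i) _ (delta_mx s s)).
rewrite mulmxDr -scalemxAr mxtraceD mxtraceZ !trG !trD => /eqP.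
by rewrite mulNr addrC subr_eq0 => /eqP ->; rewrite mulrC [b == a]eq_sym.
Qed.

(** Commutation with the matrix units of row [0] already equates each entry of [F] with that of
    [F 0 0] times the identity. *)
Lemma central_scalar n (F : 'M[C]_n) : (forall Y, Y *m F = F *m Y) ->
  exists c, F = c%:M.
Proof.
case: n F => [|n] F comF; first by exists 0; rewrite [LHS]thinmx0 [RHS]thinmx0.
exists (F 0 0); apply/matrixP => i j.
have /matrixP/(_ 0 j) := comF (delta_mx 0 i).
rewrite mxE (bigD1 i) //= big1 => [|l /negPf li]; last first.
  by rewrite mxE li andbF mul0r.
rewrite [in RHS]mxE (bigD1 0) //= big1 => [|l /negPf l0]; last first.
  by rewrite mxE l0 mulr0.
by rewrite !mxE !eqxx mul1r !addr0 /= mulr_natr [j == i]eq_sym.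
Qed.

Lemma trace1_dim_gt0 n (A : 'M[C]_n) : \tr A = 1 -> (0 < n)%N.
Proof.
by case: n A => // A /eqP; rewrite /mxtrace big_ord0 eq_sym oner_eq0.
Qed.

Lemma unitary_scheme_trivial (X : finType) d k xi
    (Ch : {linear 'M[C]_(d * k) -> 'M[C]_(d * k)}) (Z : X -> 'M[C]_k) :
  measurement_scheme xi Ch Z -> unitary_channel Ch ->
  (forall x D rho, \tr D = 0 -> scheme_map Ch (Z x) D rho = 0) ->
  forall x, exists c : C, forall rho,
    \tr (scheme_map Ch (Z x) xi rho) = c * \tr rho.
Proof.
move=> [[_ trxi] _ _ sumZ] [U [Uu ChE]] free x.
pose s := Ordinal (trace1_dim_gt0 trxi).
(* [heis] is the Heisenberg dual of the channel, multiplicative because [U] is unitary; [red] is its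
   system block at the apparatus index [s]. *)
pose heis (Y : 'M[C]_(d * k)) := U ^t* *m Y *m U.
pose red (Y : 'M[C]_(d * k)) : 'M[C]_d :=
  \matrix_(i, j) heis Y (mxtens_index (i, s)) (mxtens_index (j, s)).
have heis_free y B rho D : \tr D = 0 ->
    \tr (heis (B *t Z y) *m (rho *t D)) = 0.
  move=> trD; rewrite /heis -!mulmxA mxtrace_mulC -!mulmxA.
  rewrite [U *m (_ *m _)]mulmxA -ChE -trace_mul_ptrA.
  by rewrite [ptrA _]free // mulmx0 mxtrace0.
have heisZ y B : heis (B *t Z y) = red (B *t Z y) *t 1%:M.
  by apply: apparatus_scalar => rho D trD; apply: heis_free.
have heis_sum (Y : X -> 'M[C]_(d * k)) : \sum_y heis (Y y) = heis (\sum_y Y y).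
  by rewrite /heis mulmx_sumr mulmx_suml.
have heis1 B : heis (B *t 1%:M) = red (B *t 1%:M) *t 1%:M.
  apply: apparatus_scalar => rho D trD.
  rewrite -(sum_tens1 B sumZ) -heis_sum mulmx_suml linear_sum.
  by apply: big1 => y _; apply: heis_free.
have UU : U *m U ^t* = 1%:M by apply/unitarymxP.
have UU' : U ^t* *m U = 1%:M by apply: mulmx1C.
have heisM Y Y' : heis Y *m heis Y' = heis (Y *m Y').
  by rewrite /heis -!mulmxA [U *m (_ *m _)]mulmxA UU mul1mx.
(* By completeness of [Z] this is the sum over outcomes of the maps [B |-> red (B *t Z y)]. *)
pose f B := red (B *t 1%:M).
have heisP a Y Y' : heis (a *: Y + Y') = a *: heis Y + heis Y'.
  by rewrite /heis mulmxDr mulmxDl -scalemxAr -scalemxAl.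
have f_lin : linear f.
  move=> a B B'; apply/matrixP => i j.
  by rewrite /f (tens_linear_l _ a B B') [LHS]mxE heisP !mxE.
pose fl : {linear 'M[C]_d -> 'M[C]_d} :=
  HB.pack f (GRing.isLinear.Build C 'M[C]_d 'M[C]_d *:%R f f_lin).
have f_inj B : fl B = 0 -> B = 0.
  rewrite /= => fB0; have : B *t (1%:M : 'M[C]_k) = 0.
    have : heis (B *t 1%:M) = 0 by rewrite heis1 -/(f B) fB0 tens0mx.
    move=> /(congr1 (fun Y => U *m Y *m U ^t*)).
    rewrite /heis !mulmxA UU mul1mx.
    by rewrite -mulmxA UU mulmx1 mulmx0 mul0mx.
  move=> B0; apply/matrixP => i j.
  have /matrixP/(_ (mxtens_index (i, s)) (mxtens_index (j, s))) := B0.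
  by rewrite tensmxE !mxE eqxx mulr1.
have [c Fc] : exists c, red (1%:M *t Z x) = c%:M.
  apply: central_scalar => Y; have [B <-] := lin_inj_surj f_inj Y.
  (* Since [f] is onto, it suffices to commute with its values; this is inherited from [B (x) 1] and
     [1 (x) Z x] acting on different factors. *)
  have : heis (B *t 1%:M) *m heis (1%:M *t Z x) =
         heis (1%:M *t Z x) *m heis (B *t 1%:M).
    by rewrite !heisM !tensmx_mul !mulmx1 !mul1mx.
  rewrite heis1 heisZ !tensmx_mul !mulmx1 => E.
  apply/matrixP => i j.
  have /matrixP/(_ (mxtens_index (i, s)) (mxtens_index (j, s))) := E.
  by rewrite !tensmxE [1%:M s s]mxE eqxx !mulr1.
exists c => rho; rewrite /scheme_map -[ptrA _]mul1mx trace_mul_ptrA ChE.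
have -> : \tr ((1%:M *t Z x) *m (U *m (rho *t xi) *m U ^t*)) =
          \tr (heis (1%:M *t Z x) *m (rho *t xi)).
  by rewrite /heis -!mulmxA [RHS]mxtrace_mulC -!mulmxA.
by rewrite heisZ Fc tensmx_mul mul1mx trace_tens trxi mulr1 mul_scalar_mx
           mxtraceZ.
Qed.

End Schemes.

Theorem theorem5 (R : realType) (d k : nat) (X : finType)
    (E : X -> 'M[R[i]]_d) (xi : 'M[R[i]]_k)
    (Ch : {linear 'M[R[i]]_(d * k) -> 'M[R[i]]_(d * k)})
    (Z : X -> 'M[R[i]]_k) (I : X -> {linear 'M[R[i]]_d -> 'M[R[i]]_d}) :
  (2 <= d)%N ->
  observable E -> nontrivial_observable E ->
  measurement_scheme xi Ch Z -> third_law_scheme xi Ch ->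
  implements xi Ch Z I -> E_instrument E I ->
  extremal_instrument I ->
  (forall x, Num.sqrt (d%:R : R) <= (\rank (E x))%:R) /\ ~ unitary_channel Ch.
Proof.
move=> d_ge2 [EN0 _ _ _] [x0 E_nontriv] ms [pxi tl] impl EI extI.
have [[psd_xi trxi] _ pZ _] := ms; have [cpI trI] := EI.
have instI : instrument I.
  split=> // Y; have [_ <-] := scheme_map_instrument ms psd_xi trxi.
  by congr (\tr _); apply: eq_bigr => x _; apply: impl.
split=> [x|unitCh].
  (* If [Z x] were zero, all probabilities of [x] would vanish and [E x] would be zero by
     separation. *)
  have ZN0 : Z x != 0.
    apply: contraNneq (EN0 x) => Zx0; apply/eqP/state_sep => rho st.
    have -> : \tr (E x *m rho) = 0; last by [].
    by rewrite -trI // impl Zx0 tensmx0 mul0mx linear0 mxtrace0.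
  have dk_gt0 : (0 < d * k)%N.
    by rewrite muln_gt0 (ltnW d_ge2) (trace1_dim_gt0 trxi).
  have unitI : I x 1%:M \in unitmx.
    by rewrite impl; apply/pd_unit/ptrA_pd => //; apply/third_law_pd/pd_tens1.
  have le_d := sqrt_dim_le_rank EI instI extI unitI.
  rewrite -[leRHS]ger0_norm ?ler0n // -sqrtr_sqr ler_wsqrtr //.
  by rewrite -natrX ler_nat.
have [c trc] := unitary_scheme_trivial ms unitCh
  (extremal_apparatus_free ms pxi impl extI) x0.
(* The outcome probability is [c] on every state, so states cannot separate [E x0] from [c%:M]. *)
apply: E_nontriv; exists c; apply/eqP; rewrite -subr_eq0.
apply/eqP/state_sep => rho st.
rewrite mulmxBl mul_scalar_mx -scaleN1r mxtraceD !mxtraceZ mulN1r.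
by rewrite -trI // impl [\tr _]trc subrr.
Qed.
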